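(* Let $\phi$ be the signed distance function of an object $\Omega_0\subset\mathbb{R}^2$. If $\phi$ is $C^2$ almost everywhere, then the convexity of $\Omega_0$ is equivalent to $\Delta\phi\ge 0$ almost everywhere.
   Context: An object $\Omega_0$ is a region in the plane $\mathbb{R}^2$, with boundary $C=\partial\Omega_0$. For $x\in\mathbb{R}^2$ put $\mathrm{dist}(x,C)=\min_{y\in C}\|x-y\|_2$. The signed distance function of $\Omega_0$ is $$\phi(x)=\begin{cases}-\mathrm{dist}(x,C), & x \text{ inside } C,\\ \ \ \mathrm{dist}(x,C), & x\text{ outside } C,\end{cases}$$ where ''inside $C$'' means in $\Omega_0$ and ''outside $C$'' means not in $\Omega_0$; thus $C=\{x:\phi(x)=0\}$ and $\Omega_0=\{x:\phi(x)\le 0\}$. ''$\phi$ is $C^2$ almost everywhere'' means that there is a Lebesgue-null set $N\subset\mathbb{R}^2$ such that every point of $\mathbb{R}^2\setminus N$ has an open neighbourhood on which $\phi$ is twice continuously differentiable. $\Delta\phi=\partial_{x_1}^2\phi+\partial_{x_2}^2\phi$ is the Laplacian, evaluated at the points where $\phi$ is $C^2$; ''almost everywhere'' refers to Lebesgue measure. *)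

(* Defs.v *)
From mathcomp Require Export all_boot all_order all_algebra.
From mathcomp Require Export all_classical all_reals all_analysis.
Export Order.TTheory GRing.Theory Num.Theory numFieldNormedType.Exports.

Set Implicit Arguments.
Unset Strict Implicit.
Unset Printing Implicit Defensive.

Local Open Scope classical_set_scope.
Local Open Scope ring_scope.

Section SignedDistance.
Context {R : realType}.
Implicit Types (A U : set (R * R)) (f : R * R -> R) (x y : R * R).

(* The library norm on R * R is the max norm: it yields the usual topology and
   the usual partial derivatives, but not the Euclidean distance. *)
Definition norm2 x : R := Num.sqrt (x.1 ^+ 2 + x.2 ^+ 2).

Definition boundary A : set (R * R) := closure A `\` A°.

(* For closed nonempty C, the only case used below, the infimum is a minimum. *)
Definition dist x (C : set (R * R)) : R := inf [set norm2 (x - y) | y in C].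

(* A nonempty connected open set together with none, some or all of its
   boundary points. *)
Definition region A : Prop :=
  exists U, [/\ open U, connected U, U !=set0, U `<=` A & A `<=` closure U].

(* Closedness is what makes A = {x | signed_distance A x <= 0}; the nonempty
   boundary, that is A <> setT, is what makes the signed distance defined. *)
Definition object A : Prop := [/\ region A, closed A & boundary A !=set0].

Definition signed_distance A x : R :=
  if x \in A then - dist x (boundary A) else dist x (boundary A).

Definition e1 : R * R := (1, 0).
Definition e2 : R * R := (0, 1).

(* f is k times continuously differentiable on U (meant for U open): its
   iterated partial derivatives up to order k exist and are continuous. *)
Fixpoint Ck_on (k : nat) U f : Prop :=
  (forall x, U x -> {for x, continuous f}) /\
  if k is k'.+1 then
    [/\ forall x, U x -> derivable f x e1 /\ derivable f x e2,
        Ck_on k' U ('D_e1 f) & Ck_on k' U ('D_e2 f)]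
  else True.

Definition C2_near f x : Prop := exists U, [/\ open U, U x & Ck_on 2 U f].

Definition laplacian f x : R := 'D_e1 ('D_e1 f) x + 'D_e2 ('D_e2 f) x.

Definition lebesgue_measure2 :
    {measure set (measurableTypeR R * measurableTypeR R) -> \bar R} :=
  (@lebesgue_measure R \x @lebesgue_measure R)%E.

End SignedDistance.

(* Main.v *)
Require Import Defs.
From mathcomp Require Import measurable_realfun ring lra.

Local Open Scope classical_set_scope.
Local Open Scope ring_scope.

(* Let D be the distance to the boundary of Omega0, so that the signed distance
   is -D inside and D outside.

   If Omega0 is convex, second differences of the signed distance are nonnegative
   off the boundary: inside, the balls of radii D(x+v) and D(x-v) average to a
   ball contained in Omega0; outside, one averages two nearest points.  Boundary
   points where the function is C^2 follow by continuity of the Laplacian, the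
   boundary having empty interior.

   Conversely only the interior matters.  At an interior C^2 point the Hessian of
   the signed distance annihilates the direction of the nearest boundary point,
   so a nonnegative Laplacian makes it positive semidefinite.  Since D is locally
   semiconcave, on almost every line this forces D to be at least the minimum of
   its values at the ends of any interior segment, and by continuity this holds
   on every interior segment.  Hence, for p fixed in the connected open set U
   given by the region, the set of q in U whose segment to p stays interior is
   open and closed in U; so all such segments are interior, and
   Omega0 = closure U is convex. *)

(** * Semiconcave functions of one variable *)

Section SecondDifference.
Set Implicit Arguments.
Unset Strict Implicit.
Unset Printing Implicit Defensive.
Context {R : realType}.
Implicit Types (f : R -> R) (a b e h s t : R) (V N : set (measurableTypeR R)).

Definition second_diff {U : zmodType} (f : U -> R) (x v : U) : R :=
  f (x + v) + f (x - v) - 2 * f x.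

Local Notation lambda := (@lebesgue_measure R).

(** As a function of [t] this is convex with second derivative the unit mass at [s]; integrating
    over [s] in a set therefore gives a second antiderivative of its indicator. *)
Let ramp s t : R := Num.max 0 (t - s).

Let ramp_integrable V a b t : measurable V ->
  lambda.-integrable (V `&` `[a, b]) (EFin \o (fun s => ramp s t)).
Proof.
move=> mV; apply: (@integrableS _ _ _ lambda `[a, b]%classic) => //.
  exact: measurableI.
apply: continuous_compact_integrable; first exact: segment_compact.
apply: continuous_subspaceT.
apply: (@max_fun_continuous _ _ R (cst 0) (fun s => t - s)) => x.
  exact: cvg_cst.
by apply: cvgB; [exact: cvg_cst | exact: cvg_id].
Qed.

Let second_diff_ramp_ge0 s t h : 0 <= second_diff (ramp s) t h.
Proof. by rewrite /second_diff /ramp !maxEle; do !case: ifPn; lra. Qed.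

(** For [h >= 0] the second difference is the tent of height [h] and half-width [h] centred at [s],
    which is at least [h / 2] on its middle half. *)
Let second_diff_ramp_ge s t h :
  s \in `[t - h / 2, t + h / 2] -> h / 2 <= second_diff (ramp s) t h.
Proof.
rewrite in_itv /= => /andP[]; rewrite /second_diff /ramp !maxEle.
by do !case: ifPn; lra.
Qed.

(* psi is the second antiderivative of the indicator function of V `&` [a, b]. *)
Lemma small_convex_bump V a b e : measurable V -> (lambda V < e%:E)%E ->
  exists psi : R -> R, [/\ continuous psi,
    forall t, t \in `[a, b] -> 0 <= psi t <= (b - a) * e,
    forall t h, 0 <= second_diff psi t h &
    forall t h, 0 < h -> `[t - h, t + h] `<=` V `&` `[a, b] ->
      h ^+ 2 / 2 <= second_diff psi t h].
Proof.
move=> mV Ve; pose W : set (measurableTypeR R) := V `&` `[a, b].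
have mW : measurable W by exact: measurableI.
have We : (lambda W < e%:E)%E.
  by apply: le_lt_trans Ve; apply: le_measure; rewrite ?inE//; exact: subIsetl.
have Wfin : lambda W \is a fin_num.
  by rewrite ge0_fin_numE// (lt_trans We)// ltry.
have Wr : fine (lambda W) <= e by rewrite -lee_fin fineK// ltW.
have e0 : 0 <= e by apply: le_trans Wr; exact: fine_ge0.
have rint t : lambda.-integrable W (EFin \o (fun s => ramp s t)).
  exact: ramp_integrable.
have cint (c : R) : lambda.-integrable W (EFin \o (fun=> c)).
  apply: measurable_bounded_integrable => //; last exact: bounded_cst.
  by rewrite (lt_trans We)// ltry.
have iB f g : lambda.-integrable W (EFin \o f) ->
    lambda.-integrable W (EFin \o g) ->
    lambda.-integrable W (EFin \o (fun s => f s - g s)).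
  by move=> fi gi; have := integrableB mW fi gi.
have i2 t h : lambda.-integrable W (EFin \o (fun s => ramp s (t + h) + ramp s (t - h))).
  by have := integrableD mW (rint (t + h)) (rint (t - h)).
have i3 t : lambda.-integrable W (EFin \o (fun s => 2 * ramp s t)).
  by have := integrableZl mW 2 (rint t).
pose psi t := (\int[lambda]_(s in W) ramp s t)%R.
have psi2 t h : second_diff psi t h =
    (\int[lambda]_(s in W) second_diff (ramp s) t h)%R.
  rewrite /second_diff RintegralB//.
  by rewrite RintegralD// RintegralZl.
(* Each ramp is 1-Lipschitz in [t], so integrating over [W] gives the Lipschitz constant
   [lambda W <= e]. *)
have lip s t : psi t - psi s <= `|t - s| * e.
  apply: (@le_trans _ _ (`|t - s| * fine (lambda W))); last by rewrite ler_wpM2l.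
  rewrite -Rintegral_cst// -RintegralB//; apply: le_Rintegral => //.
    exact: iB.
  move=> u _; rewrite /ramp !maxEle.
  have := ler_norm (t - s); have := normr_ge0 (t - s).
  by do !case: ifPn; lra.
exists psi; split.
- move=> x; apply/cvgrPdist_le => /= d d0; near=> y.
  have : `|x - y| * e <= d.
    apply: (@le_trans _ _ ((d / (e + 1)) * e)); last first.
      by rewrite mulrAC ler_pdivrMr ?ler_pM2l//; lra.
    apply: ler_wpM2r => //; near: y; apply: cvgr_dist_le => //.
    by apply: divr_gt0 => //; exact: ltr_wpDl.
  have := lip x y; have := lip y x; rewrite (distrC y x) => *.
  by rewrite ler_norml; lra.
- move=> t; rewrite in_itv /= => /andP[ta tb]; apply/andP; split.
    by apply: Rintegral_ge0 => s _; rewrite /ramp le_max lexx.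
  apply: (@le_trans _ _ ((b - a) * fine (lambda W))).
    rewrite -Rintegral_cst//; apply: le_Rintegral => // s [_] /=.
    by rewrite in_itv /= => /andP[] *; rewrite /ramp ge_max; lra.
  by apply: ler_wpM2l => //; lra.
- by move=> t h; rewrite psi2; apply: Rintegral_ge0 => s _.
- move=> t h h0 hW; rewrite psi2.
  pose J : set (measurableTypeR R) := `[t - h / 2, t + h / 2]%classic.
  have JW : J `<=` W.
    move=> s sJ; apply: hW; move: sJ; rewrite /J /= !in_itv /=.
    by move=> /andP[] *; apply/andP; split; lra.
  have mJ : measurable J by exact: measurable_itv.
  (* The target is the integral of the constant [h / 2] over [J], of length [h], where the tent
     dominates that constant. *)
  have -> : h ^+ 2 / 2 = (\int[lambda]_(s in W) (((fun=> h / 2) : R -> R) \_ J) s)%R.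
    rewrite -Rintegral_mkcondr (setIidr JW) Rintegral_cst//.
    suff lJ : lambda J = h%:E.
      by apply: (@eq_trans _ _ (h / 2 * h)); [lra | exact: congr1 (esym (congr1 fine lJ))].
    have := lebesgue_measure_itv `[t - h / 2, t + h / 2].
    rewrite /= lte_fin ifT; last by lra.
    by rewrite -EFinD => ->; congr EFin; lra.
  apply: le_Rintegral => //.
  - rewrite -restrict_EFin; apply/(@integrable_restrict _ _ _ lambda _ mJ _ mW).
    apply: (@integrableS _ _ _ lambda W) (cint (h / 2)) => //.
    exact: measurableI.
  - exact: iB.
  - move=> s _; rewrite patchE; case: ifPn => [|_]; last exact: second_diff_ramp_ge0.
  by rewrite inE => sJ; exact: second_diff_ramp_ge.
Unshelve. all: by end_near. Qed.

(* Minimum principle for [f - 2 K psi + e (t - a) (b - t)], where [psi] is the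
   bump attached to a thin neighbourhood of the exceptional set [N]: its second
   differences are negative both on and off that neighbourhood. *)
Lemma semiconcave_ge_min f a b (K : R) N : a <= b -> 0 <= K ->
  {within `[a, b], continuous f} -> lambda.-negligible N ->
  (forall t, t \in `]a, b[ ->
    \forall h \near 0^'+, second_diff f t h <= K * h ^+ 2) ->
  (forall t, t \in `]a, b[ -> ~ N t -> forall e, 0 < e ->
    \forall h \near 0^'+, second_diff f t h <= e * h ^+ 2) ->
  forall t, t \in `[a, b] -> Num.min (f a) (f b) <= f t.
Proof.
move=> ab K0 cf [M [mM M0 NM]] fK fN t tab; apply/ler_addgt0Pr => eta eta0.
(* [e] and [d] are chosen so that the parabola and the bump each cost at most [eta / 2] in the final
   comparison ([eb] and [db]). *)
pose e := eta / (2 * ((b - a) ^+ 2 + 1)).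
pose d := eta / (2 * (2 * K * (b - a) + 1)).
have e0 : 0 < e by apply: divr_gt0 => //; nra.
have Kab : 0 <= 2 * K * (b - a) by rewrite !mulr_ge0// subr_ge0.
have d0 : 0 < d by apply: divr_gt0 => //; lra.
have Moo : (lambda M < +oo)%E by rewrite M0.
have [V [oV MV Vd]] := lebesgue_regularity_outer mM Moo d0.
have mV : measurable V by exact: measurable_realfun.open_measurable.
have {}Vd : (lambda V < d%:E)%E.
  have mVM : measurable (V `\` M) by exact: measurableD.
  rewrite -(setDKU MV); apply: (le_lt_trans (measureU2 lambda mVM mM)).
  suff -> : (lambda (V `\` M) + lambda M = lambda (V `\` M))%E by [].
  by rewrite M0 adde0.
have [psi [cpsi psib psi0 psi1]] := small_convex_bump a b mV Vd.
pose q s := (s - a) * (b - s).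
pose g s := f s - 2 * K * psi s + e * q s.
have ck : continuous (fun s => e * q s - 2 * K * psi s).
  move=> s; apply: cvgB; apply: cvgM; try exact: cvg_cst; last exact: cpsi.
  by apply: cvgM; apply: cvgB; (exact: cvg_id || exact: cvg_cst).
have cg : {within `[a, b], continuous g}.
  rewrite (_ : g = f \+ (fun s => e * q s - 2 * K * psi s)); last first.
    by apply/funext => s; rewrite /g /=; ring.
  move=> x; apply: continuousD; first exact: cf.
  exact: (continuous_subspaceT ck).
have [c cab gmin] := EVT_min ab cg.
have gc s h : second_diff g s h =
    second_diff f s h - 2 * K * second_diff psi s h - 2 * e * h ^+ 2.
  by rewrite /second_diff /g /q; ring.
have cend : c = a \/ c = b.
  move: (cab); rewrite in_itv /= => /andP[].
  rewrite le_eqVlt => /predU1P[->|ac]; first by left.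
  rewrite le_eqVlt => /predU1P[->|cb]; first by right.
  have cab' : c \in `]a, b[ by rewrite in_itv /= ac.
  have : \forall h \near 0^'+, second_diff g c h < 0.
    (* On [V] the bump contributes at most [- K * h ^+ 2], cancelling the semiconcavity bound. Off
       [V] the bound [e * h ^+ 2] is beaten by the [- 2 * e * h ^+ 2] of the parabola. *)
    have [Vc|nVc] := pselect (V c).
      have /nbhs_ballP[r /= r0 rV] : nbhs c V by exact: open_nbhs_nbhs.
      near=> h.
      have h0 : 0 < h by [].
      have h20 : 0 < e * h ^+ 2 by rewrite mulr_gt0// exprn_gt0.
      have fh : second_diff f c h <= K * h ^+ 2 by near: h; exact: fK.
      have : h ^+ 2 / 2 <= second_diff psi c h.
        apply: psi1 => // s; rewrite /= in_itv /= => /andP[s1 s2].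
        have hca : h < c - a by near: h; apply: nbhs_right_lt; lra.
        have hbc : h < b - c by near: h; apply: nbhs_right_lt; lra.
        split; last by rewrite /= in_itv /=; apply/andP; split; lra.
        have hr : h < r by near: h; exact: nbhs_right_lt.
        by apply: rV; rewrite /ball /= ltr_norml; apply/andP; split; lra.
      move=> /(ler_wpM2l K0); rewrite gc; lra.
    near=> h.
    have h0 : 0 < h by [].
    have h20 : 0 < e * h ^+ 2 by rewrite mulr_gt0// exprn_gt0.
    have : second_diff f c h <= e * h ^+ 2.
      by near: h; apply: fN => // /NM /MV.
    by have := mulr_ge0 K0 (psi0 c h); rewrite gc; lra.
  move=> gneg; exfalso.
  have : \forall h \near (0 : R)^'+, False.
    near=> h.
    have h0 : 0 < h by [].
    have hca : h < c - a by near: h; apply: nbhs_right_lt; lra.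
    have hbc : h < b - c by near: h; apply: nbhs_right_lt; lra.
    have : second_diff g c h < 0 by near: h.
    have := gmin (c + h); have := gmin (c - h); rewrite /second_diff.
    rewrite !in_itv /= => G1 G2.
    have {}G1 := G1 _; have := G1 ltac:(apply/andP; split; lra).
    by have := G2 ltac:(apply/andP; split; lra); lra.
  by move=> /filter_ex[].
have eb : e * (b - a) ^+ 2 <= eta / 2.
  have s0 : 0 <= (b - a) ^+ 2 by exact: sqr_ge0.
  rewrite /e mulrAC ler_pdivrMr; last by lra.
  rewrite [leRHS](_ : _ = eta * ((b - a) ^+ 2 + 1)); last by field.
  by rewrite ler_pM2l//; lra.
have db : 2 * K * ((b - a) * d) <= eta / 2.
  rewrite mulrA /d mulrA ler_pdivrMr; last by lra.
  rewrite [leRHS](_ : _ = (2 * K * (b - a) + 1) * eta); last by field.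
  by rewrite ler_pM2r//; lra.
have := gmin t tab; have := psib t tab; have := psib c cab.
have q0 : q c = 0 by rewrite /q; case: cend => ->; ring.
rewrite /g q0 => /andP[_ pc] /andP[pt _] gct.
have := ler_wpM2l K0 pc; have := mulr_ge0 K0 pt.
have : e * q t <= e * (b - a) ^+ 2.
  rewrite ler_pM2l// /q; move: tab; rewrite in_itv /= => /andP[]; nra.
have : Num.min (f a) (f b) <= f c.
  by rewrite ge_min; case: cend => ->; rewrite lexx ?orbT.
lra.
Unshelve. all: by end_near. Qed.

End SecondDifference.

(** * Euclidean distance *)

Section Norm2.
Set Implicit Arguments.
Unset Strict Implicit.
Unset Printing Implicit Defensive.
Context {R : realType}.
Implicit Types (x y z a v : R * R) (c : R).

Lemma norm2_ge0 x : 0 <= norm2 x.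
Proof. exact: sqrtr_ge0. Qed.

Lemma sqr_norm2 x : norm2 x ^+ 2 = x.1 ^+ 2 + x.2 ^+ 2.
Proof. by rewrite sqr_sqrtr// addr_ge0// sqr_ge0. Qed.

Lemma norm2_le x c : 0 <= c -> x.1 ^+ 2 + x.2 ^+ 2 <= c ^+ 2 -> norm2 x <= c.
Proof. by move=> c0 xc; rewrite -[c]ger0_norm// -sqrtr_sqr ler_sqrt// sqr_ge0. Qed.

Lemma norm20 : norm2 (0 : R * R) = 0.
Proof. by rewrite /norm2 /= expr0n addr0 sqrtr0. Qed.

Lemma norm2Z c x : norm2 (c *: x) = `|c| * norm2 x.
Proof.
by rewrite /norm2 /= /GRing.scale /= !exprMn -mulrDr sqrtrM ?sqr_ge0// sqrtr_sqr.
Qed.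

Lemma norm2N x : norm2 (- x) = norm2 x.
Proof. by rewrite /norm2 /= !sqrrN. Qed.

Lemma norm2C x y : norm2 (x - y) = norm2 (y - x).
Proof. by rewrite -norm2N opprB. Qed.

Lemma norm2D x y : norm2 (x + y) <= norm2 x + norm2 y.
Proof.
apply: norm2_le; first by rewrite addr_ge0// norm2_ge0.
(* Cauchy-Schwarz, from Lagrange's identity: the defect is the square of the determinant of [x] and
   [y]. *)
have : x.1 * y.1 + x.2 * y.2 <= norm2 x * norm2 y.
  apply: (le_trans (ler_norm _)).
  rewrite -(@ler_pXn2r _ 2)// ?nnegrE ?mulr_ge0 ?norm2_ge0//.
  rewrite exprMn !sqr_norm2.
  by rewrite -normrX ger0_norm ?sqr_ge0//; have := sqr_ge0 (x.1 * y.2 - x.2 * y.1); nra.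
move=> xy; have := sqr_norm2 x; have := sqr_norm2 y; rewrite /=; nra.
Qed.

Lemma norm2_triangle z x y : norm2 (x - y) <= norm2 (x - z) + norm2 (z - y).
Proof. by rewrite -{1}(subrK z x) -addrA norm2D. Qed.

Lemma normr_le_norm2 x : `|x| <= norm2 x.
Proof.
rewrite prod_normE ge_max; apply/andP; split;
  rewrite -(@ler_pXn2r _ 2) ?nnegrE ?norm2_ge0// sqr_norm2 real_normK ?num_real//.
  by rewrite lerDl sqr_ge0.
by rewrite lerDr sqr_ge0.
Qed.

Lemma norm2_le_normr x : norm2 x <= 2 * `|x|.
Proof.
have := norm2D (x.1, 0) (0, x.2).
rewrite /norm2 /= expr0n !addr0 !add0r !sqrtr_sqr.
rewrite prod_normE maxEle; case: ifPn; lra.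
Qed.

Lemma open_norm2_ball x c : open [set y | norm2 (y - x) < c].
Proof.
rewrite openE => y /= yx; apply/nbhs_ballP; exists ((c - norm2 (y - x)) / 2) => /=.
  by apply: divr_gt0 => //; lra.
move=> z; rewrite -ball_normE /= => yz.
by have := norm2_triangle y z x; have := norm2_le_normr (y - z); rewrite (norm2C z y); lra.
Qed.

Lemma nbhs_norm2P x (U : set (R * R)) :
  nbhs x U -> exists2 c, 0 < c & forall y, norm2 (y - x) < c -> U y.
Proof.
move=> /nbhs_ballP[c /= c0 cU]; exists c => // y yx; apply: cU.
by rewrite -ball_normE /=; have := normr_le_norm2 (x - y); rewrite norm2C; lra.
Qed.

Lemma nbhs_norm2 x c : 0 < c -> nbhs x [set y | norm2 (y - x) < c].
Proof.
move=> c0; apply: open_nbhs_nbhs; split; first exact: open_norm2_ball.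
by rewrite /= subrr norm20.
Qed.

Lemma lipschitz2_continuous (f : R * R -> R) :
  (forall x y, f x - f y <= norm2 (x - y)) -> continuous f.
Proof.
move=> fl x; apply/cvgrPdist_lt => /= e e0.
apply: filterS (nbhs_norm2 x e0) => y /= yx.
have := le_lt_trans (fl y x) yx; move: yx; rewrite norm2C => yx.
have := le_lt_trans (fl x y) yx; rewrite ltr_norml => *.
by apply/andP; split; lra.
Qed.

(** Bound [2 * norm2 a * norm2 (a + v)] and [2 * norm2 a * norm2 (a - v)] by sums of squares, then
    apply the parallelogram law. *)
Lemma second_diff_norm2 a v : a != 0 ->
  second_diff norm2 a v <= norm2 v ^+ 2 / norm2 a.
Proof.
move=> a0; have na : 0 < norm2 a.
  by apply: lt_le_trans (normr_le_norm2 a); rewrite normr_gt0.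
rewrite /second_diff ler_pdivlMr//.
have p : norm2 (a + v) ^+ 2 + norm2 (a - v) ^+ 2 = 2 * (norm2 a ^+ 2 + norm2 v ^+ 2).
  by rewrite !sqr_norm2 /=; ring.
have := sqr_ge0 (norm2 a - norm2 (a + v)); have := sqr_ge0 (norm2 a - norm2 (a - v)).
lra.
Qed.

End Norm2.

(** * Distance to a nonempty set: Lipschitz bound, minimizers, semiconcavity *)

Section Dist.
Set Implicit Arguments.
Unset Strict Implicit.
Unset Printing Implicit Defensive.
Context {R : realType}.
Variable C : set (R * R).
Hypothesis C0 : C !=set0.
Implicit Types (x y z v : R * R) (e : R).

Let has_inf_norm2 x : has_inf [set norm2 (x - y) | y in C].
Proof.
split; first by case: C0 => y Cy; exists (norm2 (x - y)), y.
by exists 0 => _ [y _ <-]; exact: norm2_ge0.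
Qed.

Lemma dist_le x y : C y -> dist x C <= norm2 (x - y).
Proof.
by move=> Cy; apply: ge_inf; [have [] := has_inf_norm2 x | exists y].
Qed.

Lemma dist_approx x e : 0 < e -> exists2 y, C y & norm2 (x - y) < dist x C + e.
Proof. by move=> /inf_adherent /(_ (has_inf_norm2 x))[_ [y Cy <-]]; exists y. Qed.

Lemma dist_ge0 x : 0 <= dist x C.
Proof.
apply: lb_le_inf; first by have [] := has_inf_norm2 x.
by move=> _ [y _ <-]; exact: norm2_ge0.
Qed.

Lemma dist_lip x y : dist x C - dist y C <= norm2 (x - y).
Proof.
apply/ler_addgt0Pr => e /(dist_approx y)[z Cz yz].
by have := dist_le x Cz; have := norm2_triangle y x z; lra.
Qed.

Lemma continuous_dist : continuous (dist^~ C).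
Proof. exact: lipschitz2_continuous dist_lip. Qed.

Lemma dist_attained x : closed C -> exists2 y, C y & dist x C = norm2 (x - y).
Proof.
(* The box [B] contains every point closer to [x] than [M], and some point of [C] is that close, so
   the minimum over the compact set [C] intersected with [B] is global. *)
move=> cC; pose M := dist x C + 1.
pose B := `[x.1 - M, x.1 + M]%classic `*` `[x.2 - M, x.2 + M]%classic.
have cB : compact B by apply: compact_setX; exact: segment_compact.
have CB y : norm2 (x - y) < M -> B y.
  move=> xy; have := le_lt_trans (normr_le_norm2 _) xy.
  rewrite prod_normE gt_max => /andP[]; rewrite !ltr_norml => /andP[? ?] /andP[? ?].
  by split; rewrite /= in_itv /=; apply/andP; split; lra.
have cCB : compact (C `&` B).
  apply: (subclosed_compact _ cB); last exact: subIsetr.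
  by apply: closedI => //; apply: compact_closed => //; exact: norm_hausdorff.
have [y Cy xy] := dist_approx x ltr01.
have cf : continuous (fun y => norm2 (x - y)).
  by apply: lipschitz2_continuous => s t; have := norm2_triangle t x s; rewrite (norm2C t s); lra.
have [|z /[!inE] -[Cz Bz] zmin] :=
  compact_EVT_min _ cCB (continuous_subspaceT cf).
  by exists y; split=> //; exact: CB.
exists z => //; apply/eqP; rewrite eq_le dist_le//=.
apply: lb_le_inf; first by have [] := has_inf_norm2 x.
move=> _ [w Cw <-]; have [/CB Bw|] := ltP (norm2 (x - w)) M.
  by apply: zmin; rewrite inE.
by apply: le_trans; apply: (le_trans (zmin y _)); [rewrite inE; split=> //; exact: CB | exact: ltW].
Qed.

Lemma dist_gt0 x : closed C -> ~ C x -> 0 < dist x C.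
Proof.
move=> cC nCx; have [y Cy ->] := dist_attained x cC.
apply: lt_le_trans (normr_le_norm2 _); rewrite normr_gt0 subr_eq0.
by apply: contra_notN nCx => /eqP ->.
Qed.

(** For [y] in [C] the function [norm2 (z - y)] of [z] dominates the distance, and for [y] almost
    nearest to [x] they nearly agree at [x]; the estimate for the norm carries over. *)
Lemma second_diff_dist x v : 0 < dist x C ->
  second_diff (dist^~ C) x v <= norm2 v ^+ 2 / dist x C.
Proof.
move=> d0; apply/ler_addgt0Pr => e e0.
have e2 : 0 < e / 2 by apply: divr_gt0.
have [y Cy xy] := dist_approx x e2.
have xy0 := lt_le_trans d0 (dist_le x Cy).
have := @second_diff_norm2 R (x - y) v; rewrite /second_diff.
rewrite [x - y + v]addrAC [x - y - v]addrAC => /(_ _)H.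
have {}H := H ltac:(by apply: contraTneq xy0 => ->; rewrite norm20 ltxx).
have : norm2 v ^+ 2 / norm2 (x - y) <= norm2 v ^+ 2 / dist x C.
  rewrite ler_wpM2l ?sqr_ge0// lef_pV2// ?posrE//; exact: dist_le.
by have := dist_le (x + v) Cy; have := dist_le (x - v) Cy; lra.
Qed.

End Dist.

(** * Distance to the boundary of a set, and midpoint convexity *)

Section Boundary.
Set Implicit Arguments.
Unset Strict Implicit.
Unset Printing Implicit Defensive.
Context {R : realType}.
Implicit Types (A : set (R * R)) (x y z v : R * R).

Lemma closed_boundary A : closed (boundary A).
Proof.
rewrite /boundary setDE; apply: closedI; first exact: closed_closure.
exact/open_closedC/open_interior.
Qed.

Lemma continuous_line x v : continuous (fun t : R => x + t *: v).
Proof.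
move=> t; apply: (@continuousD _ _ _ (cst x) (fun t : R => t *: v)).
  exact: cst_continuous.
exact: scalel_continuous.
Qed.

(** On a segment missing the boundary, closure and interior of [A] coincide. The parameters of
    interior points would be nonempty, open and closed in [0, 1], hence all of it, against the
    choice of [z]. *)
Lemma boundary_segment A x z : closure A x -> ~ A° z ->
  exists2 t, 0 <= t <= 1 & boundary A (x + t *: (z - x)).
Proof.
move=> Ax Az; apply: contrapT => nC.
pose p (t : R) := x + t *: (z - x).
have cp : continuous p by exact: continuous_line.
have clint t : 0 <= t <= 1 -> closure A (p t) -> A° (p t).
  by move=> t01 At; apply: contrapT => nAt; apply: nC; exists t.
have p1 : p 1 = z by rewrite /p scale1r addrC subrK.
suff /seteqP[_ /(_ 1)] : `[0, 1]%classic `&` p @^-1` (A°) = `[0, 1]%classic.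
  by case; rewrite /= ?p1// in_itv /= lexx ler01.
apply: (@segment_connected R 0 1).
- exists 0; split; first by rewrite /= in_itv /= lexx ler01.
  by apply: clint; rewrite ?lexx ?ler01// /p scale0r addr0.
- exists (p @^-1` (A°)) => //; apply: open_comp; last exact: open_interior.
  by move=> t _; exact: cp.
- exists (p @^-1` (closure A)).
    by apply: closed_comp; [move=> t _; exact: cp | exact: closed_closure].
  apply/seteqP; split=> t [t01 At]; split=> //.
    by apply: subset_closure; exact: interior_subset.
  by apply: clint => //; move: t01; rewrite /= in_itv.
Qed.

Lemma dist_boundary_segment A x z : closure A x -> ~ A° z ->
  dist x (boundary A) <= norm2 (x - z) /\ dist z (boundary A) <= norm2 (x - z).
Proof.
move=> Ax Az; have [t /andP[t0 t1] Ct] := boundary_segment Ax Az.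
have C0 : boundary A !=set0 by eexists; exact: Ct.
have n0 := norm2_ge0 (x - z).
split; apply: (le_trans (dist_le C0 _ Ct)).
  rewrite opprD addrA subrr add0r -scalerN opprB norm2Z ger0_norm//; nra.
rewrite (_ : z - _ = (t - 1) *: (x - z)); last first.
  by apply: injective_projections; rewrite /= /GRing.scale /=; ring.
rewrite norm2Z ler0_norm; last by lra.
nra.
Qed.

Lemma interior_dist A x z : closure A x -> norm2 (x - z) < dist x (boundary A) -> A° z.
Proof.
move=> Ax; apply: contraPP => Az; apply/negP; rewrite -leNgt.
by have [] := dist_boundary_segment Ax Az.
Qed.

Lemma second_diff_dist_inside A x v :
  (forall y z, A y -> A z -> A (2^-1 *: (y + z))) -> boundary A !=set0 ->
  A (x + v) -> A (x - v) -> second_diff (dist^~ (boundary A)) x v <= 0.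
Proof.
move=> midA C0; pose C := boundary A; pose D := dist^~ C.
move=> Ap Am; rewrite leNgt; apply/negP => gt0.
pose r := D (x + v); pose s := D (x - v).
have r0 : 0 <= r by exact: dist_ge0.
have s0 : 0 <= s by exact: dist_ge0.
have Dx : D x < (r + s) / 2 by move: gt0; rewrite /second_diff -/C -/(D x) -/r -/s; lra.
have D0 : 0 <= D x by exact: dist_ge0.
(* Shifts shorter than [D u] stay in [A]; when [D u = 0] only the zero shift is claimed. *)
have shift c u w : A u -> 0 <= c -> (0 < D u -> c * norm2 w < D u) ->
    (D u = 0 -> c = 0) -> A (u + c *: w).
  move=> Au c0 cw cu; have [Du|Du] := ltP 0 (D u); last first.
    by rewrite cu ?scale0r ?addr0//; apply/eqP; rewrite eq_le Du dist_ge0.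
  apply: interior_subset; apply: (@interior_dist _ u); first exact: subset_closure.
  by rewrite opprD addrA subrr add0r norm2N norm2Z ger0_norm// cw.
(* The offset [u - x] is split between the two centres in proportion to their radii [r] and [s]; the
   midpoint of the two shifted centres is [u]. *)
have ball u : norm2 (u - x) < (r + s) / 2 -> A u.
  move=> ux; have rs : 0 < r + s by lra.
  have Au1 : A (x + v + (2 * r / (r + s)) *: (u - x)).
    apply: shift => //; first by rewrite divr_ge0 ?mulr_ge0// ltW.
      rewrite -/r => r1; rewrite mulrAC ltr_pdivrMr//.
      by rewrite (_ : 2 * r * _ = r * (2 * norm2 (u - x))) ?ltr_pM2l//; [lra | ring].
    by move=> Dr; rewrite /r Dr mulr0 mul0r.
  have Au2 : A (x - v + (2 * s / (r + s)) *: (u - x)).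
    apply: shift => //; first by rewrite divr_ge0 ?mulr_ge0// ltW.
      rewrite -/s => s1; rewrite mulrAC ltr_pdivrMr//.
      by rewrite (_ : 2 * s * _ = s * (2 * norm2 (u - x))) ?ltr_pM2l//; [lra | ring].
    by move=> Ds; rewrite /s Ds mulr0 mul0r.
  have := midA _ _ Au1 Au2; congr A; have := lt0r_neq0 rs.
  by move=> rs0; apply: injective_projections; rewrite /= /GRing.scale /=; field.
(* The boundary point nearest to [x] lies at distance [D x < (r + s) / 2], inside an open ball
   contained in [A], so it would be interior. *)
have [y Cy xy] := dist_attained C0 x (@closed_boundary A).
apply: (Cy.2); apply: filterS ball _; apply: open_nbhs_nbhs; split.
  exact: open_norm2_ball.
by rewrite /= norm2C -xy.
Qed.

(** The midpoint of the points nearest to [x + v] and [x - v] lies in [A], and the segment from it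
    to [x] crosses the boundary. So [dist x] is at most the norm of the averaged displacements. *)
Lemma second_diff_dist_outside A x v :
  (forall y z, A y -> A z -> A (2^-1 *: (y + z))) -> closed A ->
  boundary A !=set0 -> ~ A x -> 0 <= second_diff (dist^~ (boundary A)) x v.
Proof.
move=> midA cA C0 Ax; rewrite /second_diff.
have CA y : boundary A y -> A y by move=> [+ _]; rewrite -(closure_id A).1.
have [y Cy ->] := dist_attained C0 (x + v) (@closed_boundary A).
have [z Cz ->] := dist_attained C0 (x - v) (@closed_boundary A).
have Aw := midA _ _ (CA _ Cy) (CA _ Cz).
have [_] := dist_boundary_segment (subset_closure Aw) (contra_not (@interior_subset _ A x) Ax).
rewrite (_ : _ - x = - (2^-1 *: ((x + v - y) + (x - v - z)))).
  rewrite norm2N norm2Z ger0_norm//.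
  by have := norm2D (x + v - y) (x - v - z); lra.
by apply: injective_projections; rewrite /= /GRing.scale /=; field.
Qed.

End Boundary.

(** * Second-order Taylor expansion *)

Section Taylor.
Set Implicit Arguments.
Unset Strict Implicit.
Unset Printing Implicit Defensive.
Context {R : realType}.
Implicit Types (f g : R * R -> R) (x y z v : R * R) (s t h e : R).

Lemma is_derive_line g x v t (dg : R) :
  is_derive (x + t *: v) v g dg <-> is_derive t (1 : R) (fun s => g (x + s *: v)) dg.
Proof.
have E : (fun h => h^-1 *: ((g \o shift (x + t *: v)) (h *: v) - g (x + t *: v))) =
   (fun h => h^-1 *: (((fun s => g (x + s *: v)) \o shift t) (h *: (1 : R)) - g (x + t *: v))).
  apply/funext => h /=; congr (_ *: (g _ - _)).
  by rewrite [h%:A]mulr1 scalerDl addrCA.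
split=> -[gx gd]; split.
- by move: gx; rewrite /derivable E.
- by rewrite -gd /derive E.
- by move: gx; rewrite /derivable E.
- by rewrite -gd /derive E.
Qed.

(** A mean value theorem from 0 to [s] for [s] of either sign, with the intermediate point
    controlled only in absolute value. *)
Lemma MVT_0 (F dF : R -> R) s :
  (forall c, `|c| <= `|s| -> is_derive c (1 : R) F (dF c)) ->
  exists2 c, `|c| <= `|s| & F s - F 0 = dF c * s.
Proof.
move=> Fd.
have Fc (a b : R) : `|a| <= `|s| -> `|b| <= `|s| -> {within `[a, b], continuous F}.
  move=> as_ bs; apply: derivable_within_continuous => c; rewrite in_itv /= => /andP[ac cb].
  have : `|c| <= `|s|.
    move: as_ bs; rewrite !ler_norml => /andP[? _] /andP[_ ?].
    by apply/andP; split; lra.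
  by move/Fd => -[].
have [s0|s0|->] := ltgtP s 0.
- have [||c] := @MVT _ F dF s 0 s0.
  + move=> c; rewrite in_itv /= => /andP[sc c0]; apply: Fd.
    by rewrite !ltr0_norm//; lra.
  + by apply: Fc; rewrite ?normr0.
  rewrite in_itv /= => /andP[sc c0] E; exists c; first by rewrite !ltr0_norm//; lra.
  by rewrite -opprB E; ring.
- have [||c] := @MVT _ F dF 0 s s0.
  + move=> c; rewrite in_itv /= => /andP[sc c0]; apply: Fd.
    by rewrite !gtr0_norm//; lra.
  + by apply: Fc; rewrite ?normr0.
  rewrite in_itv /= => /andP[sc c0] E; exists c; first by rewrite !gtr0_norm//; lra.
  by rewrite E subr0.
- by exists 0 => //; rewrite mulr0 subrr.
Qed.

(** The increment is split into a step along [e2] followed by one along [e1]. The mean value theorem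
    on each leaves partial derivatives at points near [x], where continuity applies. *)
Lemma is_derive_C1 g (U : set (R * R)) x v : open U -> U x ->
  (forall y, U y -> derivable g y e1 /\ derivable g y e2) ->
  {for x, continuous ('D_e1 g)} -> {for x, continuous ('D_e2 g)} ->
  is_derive x v g (v.1 * 'D_e1 g x + v.2 * 'D_e2 g x).
Proof.
move=> oU Ux dg c1 c2.
set L := v.1 * _ + _.
suff H : h^-1 *: ((g \o shift x) (h *: v) - g x) @[h --> 0^'] --> L.
  split; first by apply/cvg_ex; exists L.
  exact: cvg_lim H.
apply/cvgrPdist_le => /= e e0.
pose M := `|v.1| + `|v.2| + 1.
have M0 : 0 < M by rewrite /M; have := normr_ge0 v.1; have := normr_ge0 v.2; lra.
have eM : 0 < e / M by exact: divr_gt0.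
have [r r0 rU] : exists2 r, 0 < r & forall y, norm2 (y - x) < r ->
   [/\ U y, `|'D_e1 g x - 'D_e1 g y| <= e / M & `|'D_e2 g x - 'D_e2 g y| <= e / M].
  apply: nbhs_norm2P; near=> y; split.
  - by near: y; exact: open_nbhs_nbhs.
  - by near: y; move/cvgrPdist_le: c1; exact.
  - by near: y; move/cvgrPdist_le: c2; exact.
near=> h.
have h0 : h != 0 by near: h; exact: nbhs_dnbhs_neq.
have hr : `|h| * M < r.
  rewrite -ltr_pdivlMr//; near: h.
  apply: dnbhs0_lt; exact: divr_gt0.
have small (a b : R) : `|a| <= `|h| * `|v.1| -> `|b| <= `|h| * `|v.2| ->
    norm2 (x + b *: e2 + a *: e1 - x) < r.
  move=> ha hb; apply: le_lt_trans hr.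
  rewrite addrAC [x + _]addrC addrK.
  apply: (le_trans (norm2D _ _)); rewrite !norm2Z.
  have n1 : norm2 (e1 : R * R) = 1 by rewrite /norm2 /= expr1n expr0n addr0 sqrtr1.
  have n2 : norm2 (e2 : R * R) = 1 by rewrite /norm2 /= expr1n expr0n add0r sqrtr1.
  by rewrite n1 n2 !mulr1 /M !mulrDr mulr1; have := normr_ge0 h; lra.
pose y := x + (h * v.2) *: e2.
have [|a ah E1] := @MVT_0 (fun s => g (y + s *: e1)) (fun s => 'D_e1 g (y + s *: e1)) (h * v.1).
  move=> c ch; apply/is_derive_line; apply: derivableP.
  by have [|Uy _ _] := rU (y + c *: e1); [apply: small; rewrite -?normrM | have [] := dg _ Uy].
have [|b bh E2] := @MVT_0 (fun s => g (x + s *: e2)) (fun s => 'D_e2 g (x + s *: e2)) (h * v.2).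
  move=> c ch; apply/is_derive_line; apply: derivableP.
  have [|Uy _ _] := rU (x + c *: e2 + 0 *: e1).
    by apply: small; rewrite ?normr0 -?normrM ?mulr_ge0//.
  by move: Uy; rewrite scale0r addr0 => Uy; have [] := dg _ Uy.
have -> : h *: v + x = y + (h * v.1) *: e1.
  by apply: injective_projections; rewrite /y /= /GRing.scale /=; ring.
have -> : g (y + (h * v.1) *: e1) - g x =
    'D_e1 g (y + a *: e1) * (h * v.1) + 'D_e2 g (x + b *: e2) * (h * v.2).
  by rewrite -E1 -E2 !scale0r !addr0 /y addrA subrK.
have [_ D1 _] : [/\ U (y + a *: e1), `|'D_e1 g x - 'D_e1 g (y + a *: e1)| <= e / M &
    `|'D_e2 g x - 'D_e2 g (y + a *: e1)| <= e / M].
  by apply: rU; apply: small; rewrite -normrM.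
have [_ _ D2] : [/\ U (x + b *: e2), `|'D_e1 g x - 'D_e1 g (x + b *: e2)| <= e / M &
    `|'D_e2 g x - 'D_e2 g (x + b *: e2)| <= e / M].
  rewrite -[x + _]addr0 -(scale0r e1); apply: rU; apply: small; rewrite -?normrM//.
  by rewrite normr0.
rewrite (_ : L - _ = v.1 * ('D_e1 g x - 'D_e1 g (y + a *: e1)) +
                     v.2 * ('D_e2 g x - 'D_e2 g (x + b *: e2))).
  apply: (le_trans (ler_normD _ _)); rewrite !normrM.
  apply: (@le_trans _ _ (`|v.1| * (e / M) + `|v.2| * (e / M))).
    by apply: lerD; apply: ler_wpM2l.
  rewrite -mulrDl mulrCA ger_pMr// ler_pdivrMr// /M; lra.
by rewrite /L /GRing.scale /=; field.
Unshelve. all: by end_near. Qed.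

(** The derivative in direction [v] of the derivative in direction [v], with the two mixed partials
    kept separate. *)
Definition hessian f x v : R :=
  v.1 * (v.1 * 'D_e1 ('D_e1 f) x + v.2 * 'D_e2 ('D_e1 f) x) +
  v.2 * (v.1 * 'D_e1 ('D_e2 f) x + v.2 * 'D_e2 ('D_e2 f) x).

(** [L] is the derivative along [v]. The remainder [G] has derivative at most [e * |c|], by
    differentiability of the directional derivative [D] at [x], and the mean value theorem gives the
    bound. *)
Lemma C2_taylor f x v : C2_near f x ->
  exists L : R, forall e, 0 < e -> \forall t \near (0 : R),
    `|f (x + t *: v) - f x - L * t - hessian f x v / 2 * t ^+ 2| <= e * t ^+ 2.
Proof.
move=> [U [oU Ux /= [_ [df [cd1 [dd1 [cd11 _] [cd12 _]]] [cd2 [dd2 [cd21 _] [cd22 _]]]]]]].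
pose D y := v.1 * 'D_e1 f y + v.2 * 'D_e2 f y.
have fD y : U y -> is_derive y v f (D y).
  by move=> Uy; apply: (is_derive_C1 _ oU Uy df); [exact: cd1 | exact: cd2].
have DD : is_derive x v D (hessian f x v).
  have d1 := is_derive_C1 v oU Ux dd1 (cd11 _ Ux) (cd12 _ Ux).
  have d2 := is_derive_C1 v oU Ux dd2 (cd21 _ Ux) (cd22 _ Ux).
  exact: (is_deriveD (is_deriveZ v.1 d1) (is_deriveZ v.2 d2)).
exists (D x) => e e0.
have {}DD : \forall t \near (0 : R),
    `|D (x + t *: v) - D x - hessian f x v * t| <= e * `|t|.
  have [dD DE] := DD.
  have : h^-1 *: ((D \o shift x) (h *: v) - D x) @[h --> 0^'] --> hessian f x v.
    by rewrite -DE; exact: dD.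
  move=> /cvgrPdist_le /(_ _ e0).
  rewrite /dnbhs /= near_withinE; apply: filterS => t /= H.
  have [->|t0] := eqVneq t 0; first by rewrite scale0r addr0 subrr mulr0 subr0 normr0 mulr0.
  have := H t0; rewrite [_ + x]addrC => {}H.
  rewrite (_ : _ - _ = - ((hessian f x v - t^-1 * (D (x + t *: v) - D x)) * t)).
    by rewrite normrN normrM ler_wpM2r.
  by field.
have UU : \forall t \near (0 : R), U (x + t *: v).
  have /= := @continuous_line R x v 0 U; apply.
  by rewrite scale0r addr0; exact: open_nbhs_nbhs.
have [d /= d0 dP] := (nbhs_ballP _ _).1 (filterI DD UU).
apply/nbhs_ballP; exists d => // t td.
pose G s := f (x + s *: v) - f x - D x * s - hessian f x v / 2 * s ^+ 2.
have bd (c : R) : `|c| <= `|t| -> ball 0 d c.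
  by move: td; rewrite -!ball_normE /= !sub0r !normrN => td ct; exact: le_lt_trans td.
have [c /bd ct|c ct] := MVT_0 (F := G)
  (dF := fun c => D (x + c *: v) - D x - hessian f x v * c) (s := t).
  have [_ Uc] := dP c ct.
  have dc : is_derive c (1 : R) (fun s => f (x + s *: v)) (D (x + c *: v)).
    by apply/is_derive_line; exact: fD.
  rewrite /G; apply: is_derive_eq.
  by rewrite /GRing.scale /=; field.
rewrite /G scale0r addr0 subrr mulr0 expr0n mulr0 !subr0 => ->.
have [Dc _] := dP c (bd c ct).
rewrite normrM; apply: (@le_trans _ _ (e * `|c| * `|t|)); first by rewrite ler_wpM2r.
by rewrite -mulrA ler_pM2l// -real_normK ?num_real// expr2 ler_wpM2r.
Qed.

End Taylor.

(** * Second differences, and the Hessian of the signed distance *)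

Section Hessian.
Set Implicit Arguments.
Unset Strict Implicit.
Unset Printing Implicit Defensive.
Context {R : realType}.
Implicit Types (f : R * R -> R) (A : set (R * R)) (x y z v : R * R) (c e : R).

Lemma near_line x v (U : set (R * R)) : nbhs x U ->
  \forall h \near (0 : R)^'+, U (x + h *: v).
Proof.
move=> Ux; apply: cvg_within.
by have /= := @continuous_line R x v 0 U; apply; rewrite scale0r addr0.
Qed.

Lemma near_lineB x v (U : set (R * R)) : nbhs x U ->
  \forall h \near (0 : R)^'+, U (x - h *: v).
Proof.
by move=> /(near_line (- v)); apply: filterS => h; rewrite scalerN.
Qed.

Lemma C2_second_diff f x v e : C2_near f x -> 0 < e ->
  \forall h \near 0^'+,
    `|second_diff f x (h *: v) - hessian f x v * h ^+ 2| <= e * h ^+ 2.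
Proof.
move=> fx e0; have [L fL] := C2_taylor v fx.
have e2 : 0 < e / 2 by apply: divr_gt0.
have [d /= d0 dP] := (nbhs_ballP _ _).1 (fL _ e2).
near=> h.
have h0 : 0 < h by [].
have hd : h < d by near: h; exact: nbhs_right_lt.
have Hp : ball (0 : R) d h by rewrite -ball_normE /= sub0r normrN gtr0_norm.
have Hm : ball (0 : R) d (- h) by rewrite -ball_normE /= sub0r opprK gtr0_norm.
have := dP _ Hp; have := dP _ Hm; rewrite /= /second_diff scaleNr sqrrN !ler_norml.
by move=> /andP[? ?] /andP[? ?]; apply/andP; split; lra.
Unshelve. all: by end_near. Qed.

Lemma hessian_ge f x v c : C2_near f x ->
  (\forall h \near 0^'+, c * h ^+ 2 <= second_diff f x (h *: v)) ->
  c <= hessian f x v.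
Proof.
move=> fx cf; apply/ler_addgt0Pr => e e0.
have [h [h0 [ch]]] := filter_ex
  (filterI (nbhs_right_gt (0 : R)) (filterI cf (C2_second_diff v fx e0))).
rewrite ler_norml => /andP[_ he].
have h2 : 0 < h ^+ 2 by rewrite exprn_gt0.
by rewrite -(ler_pM2r h2) mulrDl; lra.
Qed.

(** Comparing the expansions at [- h] and [- 2 * h] eliminates the linear coefficient and leaves the
    Hessian term alone. *)
Lemma hessian_ray f x v c : C2_near f x ->
  (\forall h \near 0^'+, f (x - h *: v) = f x + c * h) -> hessian f x v = 0.
Proof.
move=> fx fc; have [L fL] := C2_taylor v fx.
apply/eqP; rewrite -normr_le0; apply/ler_addgt0Pr => e e0; rewrite add0r.
(* The error at [- 2 * h] counts 4 times and the one at [- h] counts twice. *)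
have e6 : 0 < e / 6 by apply: divr_gt0.
have [d /= d0 dP] := (nbhs_ballP _ _).1 (fL _ e6).
have [r /= r0 rP] := (nbhs_ballP _ _).1 fc.
have [h [h0 hd hr]] : exists h : R, [/\ 0 < h, h < d / 2 & h < r / 2].
  exists (Num.min d r / 4); rewrite minEle.
  by case: ifPn; rewrite -?ltNge => *; split; lra.
have f1 : f (x - h *: v) = f x + c * h.
  by apply: rP => //; rewrite -ball_normE /= sub0r normrN gtr0_norm//; lra.
have f2 : f (x - (2 * h) *: v) = f x + c * (2 * h).
  by apply: rP; rewrite -?ball_normE /= ?sub0r ?normrN ?gtr0_norm//; lra.
have H1 : ball (0 : R) d (- h) by rewrite -ball_normE /= sub0r opprK gtr0_norm//; lra.
have H2 : ball (0 : R) d (- (2 * h)) by rewrite -ball_normE /= sub0r opprK gtr0_norm//; lra.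
have h2 : 0 < h ^+ 2 by rewrite exprn_gt0.
have := dP _ H1; have := dP _ H2; rewrite /= !scaleNr f1 f2 !ler_norml.
move=> /andP[? ?] /andP[? ?].
by apply/andP; split; rewrite -(ler_pM2r h2); lra.
Qed.

(** In the orthonormal frame of [n] and its rotation, the form with coordinates [s], [t] is
    [s * t * B + t ^+ 2 * Q], where [Q] is the trace. The lower bound involves [t] only, so letting
    [s] vary forces [B = 0]. *)
Lemma quadratic_form_ge0 (a b c n1 n2 d v1 v2 : R) :
  let q w1 w2 := a * w1 ^+ 2 + b * (w1 * w2) + c * w2 ^+ 2 in
  n1 ^+ 2 + n2 ^+ 2 = 1 -> q n1 n2 = 0 -> 0 <= a + c ->
  (forall w1 w2, - (d * (n1 * w2 - n2 * w1) ^+ 2) <= q w1 w2) ->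
  0 <= q v1 v2.
Proof.
move=> q n1E qn ac qge.
pose B := 2 * (c - a) * (n1 * n2) + b * (n1 ^+ 2 - n2 ^+ 2).
pose Q := a * n2 ^+ 2 - b * (n1 * n2) + c * n1 ^+ 2.
have QE : Q = a + c.
  transitivity ((a + c) * (n1 ^+ 2 + n2 ^+ 2) - q n1 n2); first by rewrite /Q /q; ring.
  by rewrite n1E qn; ring.
have qE s t : q (s * n1 - t * n2) (s * n2 + t * n1) = s * t * B + t ^+ 2 * Q.
  transitivity (s ^+ 2 * q n1 n2 + s * t * B + t ^+ 2 * Q); first by rewrite /B /Q /q; ring.
  by rewrite qn mulr0 add0r.
have B0 : B = 0.
  have Bge s : 0 <= s * B + (Q + d).
    have := qge (s * n1 - 1 * n2) (s * n2 + 1 * n1); rewrite qE.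
    rewrite (_ : n1 * (_ + _) - _ = n1 ^+ 2 + n2 ^+ 2); last by ring.
    by rewrite n1E expr1n; lra.
  apply/eqP/negPn/negP => B0.
  (* This value of [s] turns the bound into [0 <= -1]. *)
  have := Bge (- (Q + d + 1) / B); rewrite divfK//; lra.
have -> : q v1 v2 = q ((v1 * n1 + v2 * n2) * n1 - (v2 * n1 - v1 * n2) * n2)
                    ((v1 * n1 + v2 * n2) * n2 + (v2 * n1 - v1 * n2) * n1).
  congr q.
    by transitivity (v1 * (n1 ^+ 2 + n2 ^+ 2)); [rewrite n1E mulr1 | ring].
  by transitivity (v2 * (n1 ^+ 2 + n2 ^+ 2)); [rewrite n1E mulr1 | ring].
by rewrite qE B0 mulr0 add0r QE mulr_ge0// sqr_ge0.
Qed.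

Lemma hessianE f x (w1 w2 : R) : hessian f x (w1, w2) =
  'D_e1 ('D_e1 f) x * w1 ^+ 2 +
  ('D_e2 ('D_e1 f) x + 'D_e1 ('D_e2 f) x) * (w1 * w2) +
  'D_e2 ('D_e2 f) x * w2 ^+ 2.
Proof.
rewrite /hessian /=.
move: ('D_e1 ('D_e1 f) x) ('D_e2 ('D_e1 f) x) ('D_e1 ('D_e2 f) x) ('D_e2 ('D_e2 f) x).
by move=> a b c d; ring.
Qed.

Lemma laplacian_hessian f x : laplacian f x = hessian f x e1 + hessian f x e2.
Proof.
rewrite /laplacian !hessianE.
move: ('D_e1 ('D_e1 f) x) ('D_e2 ('D_e1 f) x) ('D_e1 ('D_e2 f) x) ('D_e2 ('D_e2 f) x).
by move=> a b c d; ring.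
Qed.

Lemma signed_distance_in A x : A x -> signed_distance A x = - dist x (boundary A).
Proof. by move=> Ax; rewrite /signed_distance mem_set. Qed.

(** [alpha] and [beta] are the normal and tangential components of [w]. Since [d + alpha >= d / 2],
    squaring the right-hand side gives at least [(d + alpha) ^+ 2 + beta ^+ 2]. *)
Lemma norm2_expansion (d n1 n2 w1 w2 : R) :
  let alpha := n1 * w1 + n2 * w2 in let beta := n1 * w2 - n2 * w1 in
  0 < d -> n1 ^+ 2 + n2 ^+ 2 = 1 -> - d / 2 <= alpha ->
  norm2 (d * n1 + w1, d * n2 + w2) <= d + alpha + beta ^+ 2 / d.
Proof.
move=> alpha beta d0 nE ad.
have b0 : 0 <= beta ^+ 2 / d by rewrite divr_ge0 ?sqr_ge0// ltW.
apply: norm2_le => /=; first by lra.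
have -> : (d * n1 + w1) ^+ 2 + (d * n2 + w2) ^+ 2 = (d + alpha) ^+ 2 + beta ^+ 2.
  have wE : w1 ^+ 2 + w2 ^+ 2 = alpha ^+ 2 + beta ^+ 2.
    transitivity ((n1 ^+ 2 + n2 ^+ 2) * (w1 ^+ 2 + w2 ^+ 2)).
      by rewrite nE mul1r.
    by rewrite /alpha /beta; ring.
  transitivity (d ^+ 2 * (n1 ^+ 2 + n2 ^+ 2) + 2 * d * alpha + (w1 ^+ 2 + w2 ^+ 2)).
    by rewrite /alpha; ring.
  by rewrite nE wE; ring.
have {1}-> : beta ^+ 2 = d * (beta ^+ 2 / d) by field; exact: lt0r_neq0.
nra.
Qed.

(* Along the segment to the nearest boundary point the distance is affine, and
   across it the distance is dominated by the distance to that point; hence the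
   Hessian of the signed distance has the normal in its kernel and its only
   other eigenvalue is the Laplacian. *)
Lemma hessian_signed_distance_ge0 A x v : boundary A !=set0 -> A° x ->
  C2_near (signed_distance A) x -> 0 <= laplacian (signed_distance A) x ->
  0 <= hessian (signed_distance A) x v.
Proof.
move=> C0 Ax phix lap.
have [y Cy xy] := dist_attained C0 x (@closed_boundary R A).
have d0 : 0 < dist x (boundary A).
  by apply: dist_gt0 => //; [exact: closed_boundary | case].
set d := dist x (boundary A) in d0 xy.
have nbA : nbhs x A by [].
pose n1 := (x.1 - y.1) / d; pose n2 := (x.2 - y.2) / d.
have dn0 : d != 0 by exact: lt0r_neq0.
have nE : n1 ^+ 2 + n2 ^+ 2 = 1.
  by rewrite /n1 /n2 !expr_div_n -mulrDl -(sqr_norm2 (x - y)) -xy divff// expf_neq0.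
have xyE : x - y = d *: (n1, n2).
  by apply: injective_projections; rewrite /= /GRing.scale /= /n1 /n2; field.
have nn : norm2 (n1, n2) = 1 by rewrite /norm2 /= nE sqrtr1.
rewrite [v]surjective_pairing hessianE.
apply: (quadratic_form_ge0 (n1 := n1) (n2 := n2) (d := 2 / d)) => //.
(* Towards [y] the distance drops by exactly [s]: at least that much because of [y], at most that
   much by the Lipschitz bound. So the signed distance rises with slope 1. *)
- rewrite -hessianE; apply: (hessian_ray (c := 1)) => //.
  near=> s.
  have s0 : 0 < s by [].
  have sd : s < d by near: s; exact: nbhs_right_lt.
  have As : A (x - s *: (n1, n2)) by near: s; exact: near_lineB.
  rewrite !signed_distance_in//; last exact: nbhs_singleton nbA.
  have := dist_le C0 (x - s *: (n1, n2)) Cy.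
  have := dist_lip C0 x (x - s *: (n1, n2)).
  have -> : x - (x - s *: (n1, n2)) = s *: (n1, n2) by rewrite opprB addrC subrK.
  rewrite addrAC xyE -scalerBl !norm2Z nn gtr0_norm// ger0_norm; last by lra.
  by rewrite -/d; lra.
(* Comparison with the distance to [y] on both sides of [x]: the terms in [alpha] cancel and
   [beta ^+ 2 / d] appears twice, whence [2 / d]. *)
- move=> w1 w2; rewrite -hessianE; apply: hessian_ge => //.
  pose alpha := n1 * w1 + n2 * w2; pose beta := n1 * w2 - n2 * w1.
  rewrite -/beta.
  (* For [h] below this bound, [h * alpha] and its opposite both lie in the range allowed by
     [norm2_expansion]. *)
  have a0 : 0 < d / 2 / (`|alpha| + 1).
    by do 2!apply: divr_gt0 => //; have := normr_ge0 alpha; lra.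
  near=> h.
  have h0 : 0 < h by [].
  have ha : h * `|alpha| <= d / 2.
    have : h < d / 2 / (`|alpha| + 1) by near: h; exact: nbhs_right_lt.
    by rewrite ltr_pdivlMr; have := normr_ge0 alpha; lra.
  have Ap : A (x + h *: (w1, w2)) by near: h; exact: near_line.
  have Am : A (x - h *: (w1, w2)) by near: h; exact: near_lineB.
  have hp : h * alpha <= d / 2.
    by apply: le_trans ha; rewrite ler_pM2l// ler_norm.
  have hm : - (d / 2) <= h * alpha.
    by rewrite lerNl; apply: le_trans ha; rewrite -mulrN ler_pM2l// -normrN ler_norm.
  rewrite /second_diff !signed_distance_in//; last exact: nbhs_singleton nbA.
  have := dist_le C0 (x + h *: (w1, w2)) Cy.
  have := dist_le C0 (x - h *: (w1, w2)) Cy.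
  have := norm2_expansion (w1 := h * w1) (w2 := h * w2) d0 nE.
  have := norm2_expansion (w1 := - h * w1) (w2 := - h * w2) d0 nE.
  rewrite (_ : (d * n1 + h * w1, d * n2 + h * w2) = x + h *: (w1, w2) - y); last first.
    by rewrite addrAC xyE; apply: injective_projections.
  rewrite (_ : (d * n1 + - h * w1, d * n2 + - h * w2) = x - h *: (w1, w2) - y); last first.
    by rewrite addrAC xyE -scaleNr; apply: injective_projections.
  have -> : n1 * (h * w1) + n2 * (h * w2) = h * alpha by rewrite /alpha; ring.
  have -> : n1 * (h * w2) - n2 * (h * w1) = h * beta by rewrite /beta; ring.
  have -> : n1 * (- h * w1) + n2 * (- h * w2) = - (h * alpha) by rewrite /alpha; ring.
  have -> : n1 * (- h * w2) - n2 * (- h * w1) = - (h * beta) by rewrite /beta; ring.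
  rewrite sqrrN => Hm Hp.
  have {}Hm := Hm ltac:(lra); have {}Hp := Hp ltac:(lra).
  have : 2 / d * beta ^+ 2 * h ^+ 2 = 2 * ((h * beta) ^+ 2 / d) by field.
  by rewrite -/d; lra.
Unshelve. all: by end_near. Qed.

End Hessian.

(** * Null sets on oblique lines *)

Section NullSections.
Set Implicit Arguments.
Unset Strict Implicit.
Unset Printing Implicit Defensive.
Local Open Scope ereal_scope.

Section General.
Context d1 d2 (T1 : measurableType d1) (T2 : measurableType d2) (R : realType).
Variable m1 : {sigma_finite_measure set T1 -> \bar R}.
Variable m2 : {sigma_finite_measure set T2 -> \bar R}.
Implicit Types M : set (T1 * T2).

Lemma integral_eq0_ae d (T : measurableType d) (m : {measure set T -> \bar R})
    (f : T -> \bar R) : measurable_fun setT f -> (forall x, 0 <= f x) ->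
  \int[m]_x f x = 0 <-> {ae m, forall x, f x = 0}.
Proof.
move=> mf f0.
rewrite (_ : \int[m]_x f x = \int[m]_x `|f x|); last first.
  by apply: eq_integral => x _; rewrite gee0_abs.
have [H1 H2] := ae_eq_integral_abs m measurableT mf; split.
- by move=> /H1; apply: filterS => x; exact.
- by move=> H; apply: H2; apply: filterS H => x.
Qed.

(** The product measure is the integral of the measures of the sections, a nonnegative function. *)
Lemma product_null_xsection M : measurable M ->
  (m1 \x m2) M = 0 <-> {ae m1, forall x, m2 (xsection M x) = 0}.
Proof. by move=> mM; apply: integral_eq0_ae => //; exact: measurable_fun_xsection. Qed.

Lemma product_null_ysection M : measurable M ->
  (m1 \x m2) M = 0 <-> {ae m2, forall y, m1 (ysection M y) = 0}.
Proof.
move=> mM; rewrite (@product_measure_unique _ _ _ _ _ m1 m2 (m1 \x^ m2))//; last first.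
  by move=> *; exact: product_measure2E.
by apply: integral_eq0_ae => //; exact: measurable_fun_ysection.
Qed.

End General.

Context {R : realType}.
Local Notation lambda := (@lebesgue_measure R).

Lemma lebesgue_measure_shift (c : R) (A : set (measurableTypeR R)) : measurable A ->
  lambda ((fun y => y + c)%R @^-1` A) = lambda A.
Proof.
move=> mA; pose f (y : measurableTypeR R) : measurableTypeR R := (y + c)%R.
have mf : measurable_fun setT f by exact: measurable_funD.
apply/esym; apply: (@lebesgue_measure_unique R (pushforward lambda f)) => //.
move=> _ [[a b] _ <-] /=.
rewrite /pushforward [X in _ = lambda X](_ : _ = `](a - c)%R, (b - c)%R]%classic).
  rewrite !lebesgue_measure_itv /= !lte_fin ltrD2r.
  by case: ifPn => // _; rewrite -!EFinD; congr EFin; ring.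
by apply/seteqP; split=> y /=; rewrite !in_itv /= ltrBlDr lerBrDr.
Qed.

(** The shear [S] translates each vertical section, so the preimage of [M] is null as well; its
    horizontal sections are the traces of [M] on the lines of slope [c]. *)
Lemma ae_null_oblique_section (M : set (measurableTypeR R * measurableTypeR R)) (c : R) :
  measurable M -> lebesgue_measure2 M = 0 ->
  {ae lambda, forall y, lambda.-negligible [set s | M (s, y + c * s)%R]}.
Proof.
move=> mM M0.
pose S (p : measurableTypeR R * measurableTypeR R) : measurableTypeR R * measurableTypeR R :=
  (p.1, p.2 + c * p.1)%R.
have mS : measurable_fun setT S.
  apply: measurable_fun_pair; first exact: measurable_fst.
  apply: measurable_funD; first exact: measurable_snd.
  by apply: measurable_funM => //; exact: measurable_fst.
have mSM : measurable (S @^-1` M) by rewrite -[X in measurable X]setTI; exact: mS.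
have : {ae lambda, forall s, lambda (xsection (S @^-1` M) s) = 0}.
  have /(product_null_xsection lambda lambda mM) := M0.
  apply: filterS => s Ms.
  rewrite -[RHS]Ms -[RHS](@lebesgue_measure_shift (c * s)%R); last exact: measurable_xsection.
  by congr (lambda _); apply/seteqP; split=> y; rewrite /xsection /= !in_setE.
move=> /(product_null_xsection lambda lambda mSM).2.
move=> /(product_null_ysection lambda lambda mSM).1.
apply: filterS => y My; exists (ysection (S @^-1` M) y); split=> //.
  exact: measurable_ysection.
by move=> s /=; rewrite /ysection /= in_setE.
Qed.

End NullSections.

(** * Distance to the boundary along interior segments *)

Section Segments.
Set Implicit Arguments.
Unset Strict Implicit.
Unset Printing Implicit Defensive.
Context {R : realType}.
Implicit Types (p q x y z v : R * R) (s t e : R).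
Local Notation lambda := (@lebesgue_measure R).

Lemma ae_dense (P : R -> Prop) (a b : R) : a < b -> {ae lambda, forall y : R, P y} ->
  exists2 y : R, a < y < b & P y.
Proof.
move=> ab [N [mN N0 PN]]; apply: contrapT => nP.
have abN : `]a, b[%classic `<=` N.
  move=> y; rewrite /= in_itv /= => yab; apply: PN => /= Py.
  by apply: nP; exists y.
have : (lambda `]a, b[%classic <= lambda N)%E by apply: le_measure; rewrite ?inE.
by rewrite N0 lebesgue_measure_itv /= lte_fin ab -EFinB lee_fin; lra.
Qed.

Variable A : set (R * R).
Hypothesis C0 : boundary A !=set0.
Let D := dist^~ (boundary A).
Let phi := signed_distance A.

Lemma dist_interior_gt0 x : A° x -> 0 < D x.
Proof. by move=> Ax; apply: dist_gt0 => //; [exact: closed_boundary | case]. Qed.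

Lemma interior_near_dist x z : A° x -> norm2 (x - z) < D x -> A° z.
Proof. by move=> /interior_subset/subset_closure; exact: interior_dist. Qed.

Lemma second_diff_dist_le0 x v e : A° x -> C2_near phi x ->
  0 <= laplacian phi x -> 0 < e ->
  \forall h \near 0^'+, second_diff D x (h *: v) <= e * h ^+ 2.
Proof.
move=> Ax phix lap e0; have hess := hessian_signed_distance_ge0 v C0 Ax phix lap.
have nbA : nbhs x A by [].
near=> h.
have Ap : A (x + h *: v) by near: h; exact: near_line.
have Am : A (x - h *: v) by near: h; exact: near_lineB.
have : `|second_diff phi x (h *: v) - hessian phi x v * h ^+ 2| <= e * h ^+ 2.
  by near: h; exact: C2_second_diff.
rewrite ler_norml => /andP[+ _].
rewrite /second_diff /phi !signed_distance_in//; last exact: nbhs_singleton nbA.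
by have := mulr_ge0 hess (sqr_ge0 h); rewrite /D /phi; lra.
Unshelve. all: by end_near. Qed.

Lemma segment_dist_gt0 p q : (forall t, 0 <= t <= 1 -> A° (p + t *: (q - p))) ->
  exists2 d, 0 < d & forall t, 0 <= t <= 1 -> d <= D (p + t *: (q - p)).
Proof.
move=> pqA.
have cD : continuous (fun t => D (p + t *: (q - p))).
  move=> t; apply: (@continuous_comp _ _ _ (fun t => p + t *: (q - p)) D).
    exact: continuous_line.
  exact: continuous_dist.
have [c c01 cmin] := EVT_min ler01 (continuous_subspaceT cD).
exists (D (p + c *: (q - p))).
  by apply: dist_interior_gt0; apply: pqA; move: c01; rewrite in_itv.
by move=> t t01; apply: cmin; rewrite in_itv.
Qed.

Hypothesis ae_lap :
  {ae (@lebesgue_measure2 R), forall x, C2_near phi x /\ 0 <= laplacian phi x}.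

(** The first coordinate parametrizes the segment and its parallels [L y]. The one-variable minimum
    principle is applied on parallels meeting the exceptional set in a null set, and these come
    arbitrarily close to [L y0]. *)
Lemma dist_ge_min_oblique p q : p.1 < q.1 ->
  (forall t, 0 <= t <= 1 -> A° (p + t *: (q - p))) ->
  forall t, 0 <= t <= 1 -> Num.min (D p) (D q) <= D (p + t *: (q - p)).
Proof.
move=> pq pqA t t01; have [d d0 dD] := segment_dist_gt0 pqA.
have [M [mM M0 MP]] := ae_lap.
pose w := q.1 - p.1; have w0 : 0 < w by rewrite subr_gt0.
pose c := (q.2 - p.2) / w.
pose y0 := p.2 - c * p.1.
pose L (y s : R) : R * R := (s, y + c * s).
have LE s : L y0 s = p + ((s - p.1) / w) *: (q - p).
  apply: injective_projections; rewrite /L /y0 /c /= /GRing.scale /=.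
    by rewrite -/w divfK ?lt0r_neq0//; ring.
  by field; exact: lt0r_neq0.
have s01 s : s \in `[p.1, q.1] -> 0 <= (s - p.1) / w <= 1.
  rewrite in_itv /= => /andP[ps sq]; rewrite ler_pdivrMr// mul1r lerD2r sq andbT.
  by apply: divr_ge0; [rewrite subr_ge0 | exact: ltW].
have Ly (y s : R) : norm2 (L y0 s - L y s) = `|y - y0|.
  rewrite /norm2 /= subrr expr0n add0r sqrtr_sqr distrC; congr (`|_|); ring.
have main (y : R) : `|y - y0| < d / 2 -> lambda.-negligible [set s | M (L y s)] ->
    forall s, s \in `[p.1, q.1] -> Num.min (D (L y p.1)) (D (L y q.1)) <= D (L y s).
  move=> yd My.
  have AL s : s \in `[p.1, q.1] -> A° (L y s) /\ d / 2 <= D (L y s).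
    move=> /s01 sI; have := pqA _ sI; have := dD _ sI; rewrite -!LE => ds As.
    split; first by apply: (interior_near_dist As); rewrite Ly; lra.
    by have := dist_lip C0 (L y0 s) (L y s); rewrite Ly; move: ds; rewrite /D; lra.
  have sdE s h : second_diff (fun s => D (L y s)) s h =
      second_diff D (L y s) (h *: (1, c)).
    rewrite /second_diff; congr (D _ + D _ - _);
      by apply: injective_projections; rewrite /L /= /GRing.scale /=; ring.
  have n1c h : norm2 (h *: (1, c)) ^+ 2 = (1 + c ^+ 2) * h ^+ 2.
    by rewrite sqr_norm2 /= /GRing.scale /=; ring.
  (* The constant combines [D >= d / 2] along the parallel with the squared length [1 + c ^+ 2] of
     its direction. *)
  apply: (@semiconcave_ge_min R _ _ _ ((1 + c ^+ 2) * (2 / d)) [set s | M (L y s)]).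
  - exact: ltW.
  - by rewrite mulr_ge0 ?addr_ge0 ?sqr_ge0// divr_ge0// ltW.
  - apply: continuous_subspaceT => s; apply: (@continuous_comp _ _ _ (L y) D).
      have -> : L y = fun s => (0, y) + s *: (1, c).
        by apply/funext => u; apply: injective_projections; rewrite /L /= /GRing.scale /=; ring.
      exact: continuous_line.
    exact: continuous_dist.
  - exact: My.
  - move=> s sI; near=> h; rewrite sdE.
    have [As ds] := AL s (subset_itv_oo_cc sI).
    apply: (le_trans (second_diff_dist C0 _ (dist_interior_gt0 As))).
    rewrite n1c mulrAC ler_wpM2r ?sqr_ge0// ler_wpM2l ?addr_ge0 ?sqr_ge0//.
    rewrite -[2 / d]invf_div lef_pV2 ?posrE ?dist_interior_gt0//.
    by rewrite divr_gt0.
  - move=> s sI nM e e0.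
    have [As ds] := AL s (subset_itv_oo_cc sI).
    under eq_near do rewrite sdE.
    have [phis laps] : C2_near phi (L y s) /\ 0 <= laplacian phi (L y s).
      by apply: contrapT => H; apply: nM; exact: MP.
    exact: second_diff_dist_le0.
apply/ler_addgt0Pr => e e0.
(* By the Lipschitz bound, passing between [y0] and [y] costs [e / 2] at the ends and [e / 2] at the
   intermediate point; [d / 2] keeps the parallel interior. *)
have [y yy0 My] : exists2 y : R, y0 - Num.min (e / 2) (d / 2) < y < y0 + Num.min (e / 2) (d / 2) &
    lambda.-negligible [set s | M (L y s)].
  apply: ae_dense; last exact: ae_null_oblique_section.
  by rewrite minEle; case: ifPn => _; lra.
have /andP[ye yd] : (`|y - y0| < e / 2) && (`|y - y0| < d / 2).
  move: yy0; rewrite minEle !ltr_norml; case: ifPn; rewrite -?ltNge => ? /andP[? ?].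
    by apply/andP; split; apply/andP; split; lra.
  by apply/andP; split; apply/andP; split; lra.
pose s := p.1 + t * w.
have sI : s \in `[p.1, q.1].
  by move: t01; rewrite in_itv /= /s /w => /andP[t0 t1]; apply/andP; split; nra.
have := main y yd My s sI.
have := dist_lip C0 (L y s) (L y0 s).
have := dist_lip C0 (L y0 p.1) (L y p.1).
have := dist_lip C0 (L y0 q.1) (L y q.1).
rewrite (norm2C (L y s)) !Ly.
have -> : L y0 s = p + t *: (q - p).
  by rewrite LE /s addrAC subrr add0r mulfK// lt0r_neq0.
have -> : L y0 p.1 = p by rewrite LE subrr mul0r scale0r addr0.
have -> : L y0 q.1 = q by rewrite LE divff ?lt0r_neq0// scale1r addrC subrK.
by rewrite /D !minEle; do 2!case: ifPn; rewrite -?ltNge; lra.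
Unshelve. all: by end_near. Qed.

Lemma dist_ge_min p q : (forall t, 0 <= t <= 1 -> A° (p + t *: (q - p))) ->
  forall t, 0 <= t <= 1 -> Num.min (D p) (D q) <= D (p + t *: (q - p)).
Proof.
move=> pqA t t01; have [pq|qp|pq] := ltgtP p.1 q.1.
- exact: dist_ge_min_oblique.
- have rev s : p + s *: (q - p) = q + (1 - s) *: (p - q).
    by apply: injective_projections; rewrite /= /GRing.scale /=; ring.
  rewrite minC rev; apply: dist_ge_min_oblique => //; last by lra.
  move=> s s01; have := pqA (1 - s); rewrite rev subKr; apply; lra.
(* A vertical or degenerate segment is tilted by moving [q] by [r] along [e1]: [r < d] keeps it
   interior, and [r < e / 2] pays for both changes in [D]. *)
have [d d0 dD] := segment_dist_gt0 pqA.
apply/ler_addgt0Pr => e e0.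
have [r [r0 rd re]] : exists r : R, [/\ 0 < r, r < d & r < e / 2].
  exists (Num.min d e / 3); rewrite minEle.
  by case: ifPn; rewrite -?ltNge => *; split; lra.
pose q' := q + r *: e1.
have n1 : norm2 (e1 : R * R) = 1 by rewrite /norm2 /= expr1n expr0n addr0 sqrtr1.
have qE s : p + s *: (q - p) - (p + s *: (q' - p)) = - (s * r) *: e1.
  by apply: injective_projections; rewrite /q' /= /GRing.scale /=; ring.
have qn s : 0 <= s <= 1 -> norm2 (p + s *: (q - p) - (p + s *: (q' - p))) <= r.
  move=> /andP[s0 s1]; rewrite qE scaleNr norm2N norm2Z n1 mulr1 ger0_norm; last by nra.
  nra.
have pqA' s : 0 <= s <= 1 -> A° (p + s *: (q' - p)).
  move=> sI; apply: (interior_near_dist (pqA _ sI)).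
  by apply: le_lt_trans (qn _ sI) _; exact: lt_le_trans rd (dD _ sI).
have pq' : p.1 < q'.1 by rewrite /q' /= pq /GRing.scale /=; lra.
have := dist_ge_min_oblique pq' pqA' t01.
have := le_trans (dist_lip C0 _ _) (qn 1 ltac:(lra)).
rewrite !scale1r ![p + (_ - p)]addrC !subrK.
have := le_trans (dist_lip C0 (p + t *: (q' - p)) (p + t *: (q - p))) _.
move=> /(_ r); rewrite norm2C => /(_ (qn t t01)).
by rewrite /D !minEle; do 2!case: ifPn; rewrite -?ltNge; lra.
Qed.

End Segments.

(** * The two implications between convexity and the sign of the Laplacian *)

Section Convexity.
Set Implicit Arguments.
Unset Strict Implicit.
Unset Printing Implicit Defensive.
Context {R : realType}.
Variable A : set (R * R).
Implicit Types (p q x y z v : R * R) (U : set (R * R)).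

Lemma closure_norm2 U x (r : R) : closure U x -> 0 < r ->
  exists2 y, U y & norm2 (y - x) < r.
Proof. by move=> Ux r0; have [y []] := Ux _ (nbhs_norm2 x r0); exists y. Qed.

Lemma convex_set_segmentP : convex_set A <->
  (forall x y t, A x -> A y -> 0 <= t <= 1 -> A (x + t *: (y - x))).
Proof.
split=> [cA x y t Ax Ay /andP[t0 t1]|cA x y l].
  have := cA y x (Itv01 t0 t1); rewrite !inE => /(_ Ay Ax).
  congr A; rewrite /conv /= /unstable.onem.
  by apply: injective_projections; rewrite /= /GRing.scale /=; ring.
rewrite !inE => Ax Ay; have := cA y x l%:num Ay Ax.
rewrite ge0 le1 => /(_ isT); congr A; rewrite /conv /= /unstable.onem.
by apply: injective_projections; rewrite /= /GRing.scale /=; ring.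
Qed.

Hypothesis C0 : boundary A !=set0.
Let D := dist^~ (boundary A).
Let phi := signed_distance A.

(** Off the boundary, small steps stay on the side of [x], where [phi] is [- D] or [D]
    throughout. *)
Lemma second_diff_signed_distance_ge0 x v : closed A -> convex_set A ->
  ~ boundary A x -> \forall h \near 0^'+, 0 <= second_diff phi x (h *: v).
Proof.
move=> cA /convex_set_segmentP segA nCx.
have midA y z : A y -> A z -> A (2^-1 *: (y + z)).
  move=> Ay Az; have := segA y z 2^-1 Ay Az; rewrite invr_ge0 invf_le1// ler0n ler1n.
  move=> /(_ isT); congr A.
  by apply: injective_projections; rewrite /= /GRing.scale /=; field.
have [Ax|Ax] := pselect (A x).
  have nbA : nbhs x A.
    by apply: contrapT => nA; apply: nCx; split=> //; exact: subset_closure.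
  near=> h.
  have Ap : A (x + h *: v) by near: h; exact: near_line.
  have Am : A (x - h *: v) by near: h; exact: near_lineB.
  have := second_diff_dist_inside midA C0 Ap Am.
  by rewrite /second_diff /phi !signed_distance_in//; lra.
have nbA : nbhs x (~` A) by apply: open_nbhs_nbhs; split=> //; exact: closed_openC.
have out z : ~ A z -> phi z = dist z (boundary A).
  by move=> Az; rewrite /phi /signed_distance memNset.
near=> h.
have Ap : (~` A) (x + h *: v) by near: h; exact: near_line.
have Am : (~` A) (x - h *: v) by near: h; exact: near_lineB.
have := second_diff_dist_outside (h *: v) midA cA C0 Ax.
by rewrite /second_diff !out.
Unshelve. all: by end_near. Qed.

Lemma laplacian_ge0_off_boundary x : closed A -> convex_set A -> C2_near phi x ->
  ~ boundary A x -> 0 <= laplacian phi x.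
Proof.
move=> cA convA phix nCx.
rewrite laplacian_hessian; apply: addr_ge0; apply: hessian_ge => //.
  by have := second_diff_signed_distance_ge0 e1 cA convA nCx; apply: filterS => h; rewrite mul0r.
by have := second_diff_signed_distance_ge0 e2 cA convA nCx; apply: filterS => h; rewrite mul0r.
Qed.

(** A neighbourhood consisting of boundary points would lie in the closed set [A] and make [x]
    interior. *)
Lemma boundary_adherent_outside x (V : set (R * R)) : closed A -> boundary A x ->
  nbhs x V -> exists2 y, V y & ~ boundary A y.
Proof.
move=> cA [_ nAx] Vx; apply: contrapT => nV; apply: nAx.
apply: filterS Vx => y Vy; apply: contrapT => nAy; apply: nV; exists y => //.
by case=> + _; rewrite -(closure_id A).1.
Qed.

Lemma laplacian_ge0 x : closed A -> convex_set A -> C2_near phi x ->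
  0 <= laplacian phi x.
Proof.
move=> cA convA phix.
have [Cx|Cx] := pselect (boundary A x); last exact: laplacian_ge0_off_boundary.
have [U [oU Ux phiU]] := phix.
have UC2 y : U y -> C2_near phi y by exists U.
have cL : {for x, continuous (laplacian phi)}.
  move: phiU => /= [_ [_ [_ [_ [c11 _] _]] [_ [_ _ [c22 _]]]]].
  by apply: continuousD; [exact: c11 | exact: c22].
rewrite leNgt; apply/negP => L0.
have near_neg : nbhs x (U `&` [set y | laplacian phi y < 0]).
  apply: filterI; first exact: open_nbhs_nbhs.
  exact: (cvgr_lt _ cL).
have [y [Uy] Ly nCy] := boundary_adherent_outside cA Cx near_neg.
by have := laplacian_ge0_off_boundary cA convA (UC2 _ Uy) nCy; rewrite leNgt Ly.
Qed.

Hypothesis ae_lap :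
  {ae (@lebesgue_measure2 R), forall x, C2_near phi x /\ 0 <= laplacian phi x}.

Lemma segment_interior U : open U -> connected U -> U `<=` A ->
  forall p q t, U p -> U q -> 0 <= t <= 1 -> A° (p + t *: (q - p)).
Proof.
move=> oU cU UA p q t Up Uq t01.
have UA0 : U `<=` A° by rewrite -open_subsetE.
pose S : set (R * R) := [set q | forall t, 0 <= t <= 1 -> A° (p + t *: (q - p))].
have D0 z : A° z -> 0 < D z by exact: dist_interior_gt0.
have move_end z z' s : 0 <= s <= 1 ->
    norm2 ((p + s *: (z - p)) - (p + s *: (z' - p))) <= norm2 (z - z').
  move=> /andP[s0 s1]; rewrite (_ : _ - _ = s *: (z - z')); last first.
    by apply: injective_projections; rewrite /= /GRing.scale /=; ring.
  by rewrite norm2Z ger0_norm//; have := norm2_ge0 (z - z'); nra.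
suff /seteqP[_ /(_ _ Uq)[_]] : U `&` S = U by exact.
apply: cU.
- exists p; split=> // s _; rewrite subrr scaler0 addr0; exact: UA0.
(* Openness: along the segment to [z] the distance is at least [Num.min (D p) (D z)], so moving the
   end by less keeps it interior. *)
- exists (S°); first exact: open_interior.
  apply/seteqP; split=> z [Uz Sz]; split=> //; last exact: interior_subset.
  have Az : A° z by exact: UA0.
  have m0 : 0 < Num.min (D p) (D z) by rewrite lt_min !D0//; exact: UA0.
  apply: filterS (nbhs_norm2 z m0) => z' zz' s s01.
  apply: (interior_near_dist (Sz _ s01)).
  apply: (le_lt_trans (move_end _ _ _ s01)); rewrite norm2C.
  exact: lt_le_trans zz' (dist_ge_min C0 ae_lap Sz s01).
(* Closedness: for [z'] in [S] within [r] of [z], both [D p] and [D z'] are at least [r]. So the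
   segment to [z'] has margin [r], more than the displacement to the segment to [z]. *)
- exists (closure S); first exact: closed_closure.
  apply/seteqP; split=> z [Uz Sz]; split=> //; first exact: subset_closure.
  pose r := Num.min (D p) (D z) / 2.
  have r0 : 0 < r by rewrite divr_gt0// lt_min !D0//; exact: UA0.
  have [z' Sz' zz'] := closure_norm2 Sz r0.
  move=> s s01; apply: (interior_near_dist (Sz' _ s01)).
  rewrite norm2C; apply: (le_lt_trans (move_end _ _ _ s01)); rewrite norm2C.
  apply: (lt_le_trans zz'); apply: le_trans (dist_ge_min C0 ae_lap Sz' s01).
  have := dist_lip C0 z z'; rewrite norm2C; move: zz'.
  have := D0 z (UA0 _ Uz); have := D0 p (UA0 _ Up).
  by rewrite /r /D !minEle; do 2!case: ifPn; rewrite -?ltNge; lra.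
Qed.

Lemma region_convex : region A -> closed A -> convex_set A.
Proof.
move=> [U [oU cU _ UA AU]] cA; apply/convex_set_segmentP => x y t Ax Ay t01.
apply: contrapT => nA.
have nbA : nbhs (x + t *: (y - x)) (~` A).
  by apply: open_nbhs_nbhs; split=> //; exact: closed_openC.
have [r r0 rA] := nbhs_norm2P nbA.
(* With ends in [U] closer than [r] to [x] and [y], the corresponding point of the new segment is
   within [r] of the supposedly missing one. *)
have [p Up px] := closure_norm2 (AU _ Ax) r0.
have [q Uq qy] := closure_norm2 (AU _ Ay) r0.
apply: (rA (p + t *: (q - p))); last first.
  by apply: interior_subset; exact: segment_interior oU cU UA _ _ _ Up Uq t01.
rewrite (_ : _ - _ = (1 - t) *: (p - x) + t *: (q - y)); last first.
  by apply: injective_projections; rewrite /= /GRing.scale /=; ring.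
apply: (le_lt_trans (norm2D _ _)); rewrite !norm2Z.
case/andP: t01 => t0 t1; rewrite !ger0_norm//; last by lra.
have [->|t00] := eqVneq t 0; first by rewrite subr0 mul1r mul0r addr0.
have : 0 < t by rewrite lt_def t00.
nra.
Qed.

End Convexity.

Theorem theorem2 (R : realType) (Omega0 : set (R * R)) (hO : object Omega0)
    (hC2 : {ae (@lebesgue_measure2 R),
      forall x : R * R, C2_near (signed_distance Omega0) x}) :
  convex_set Omega0 <->
  {ae (@lebesgue_measure2 R),
    forall x : R * R, C2_near (signed_distance Omega0) x ->
      0 <= laplacian (signed_distance Omega0) x}.
Proof.
have [regO clO C0] := hO; split=> [convO|lapO].
  by apply: aeW => x; exact: laplacian_ge0.
apply: region_convex => //.
apply: negligibleS (negligibleU hC2 lapO) => x nx.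
apply: contrapT => /= /not_orP[/contrapT phix /contrapT lapx].
by apply: nx; split=> //; exact: lapx.
Qed.
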